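(* Let $c\ge 2$, and let $G=\langle a_1,\dots,a_n\mid r_1,\dots,r_m\rangle_{\mathcal N_c}$ be a finitely generated nilpotent group given by a finite full rank presentation. If $m\le n-1$, then in any direct decomposition of $G$ all but one of the direct factors are finite.
   Context: $\mathcal N_c$ is the variety of all nilpotent groups of class at most $c$. For $A=\{a_1,\dots,a_n\}$ and a finite set $R=\{r_1,\dots,r_m\}$ of words in $A^{\pm1}$, $\langle A\mid R\rangle_{\mathcal N_c}=N_c(A)/\langle\langle R\rangle\rangle$, where $N_c(A)=F(A)/\gamma_{c+1}(F(A))$ is the free group in $\mathcal N_c$ with basis $A$ and $\langle\langle R\rangle\rangle$ is the normal closure of $R$. The relation matrix $M(A,R)$ is the $m\times n$ integer matrix whose $(i,j)$ entry is the sum of the exponents of all occurrences of $a_j$ in $r_i$; the presentation has full rank if $\operatorname{rank}M(A,R)=\min\{m,n\}$. *)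

(* Defs.v *)
From HB Require Import structures.
From mathcomp Require Import all_boot all_order all_algebra.
From mathcomp Require Import all_classical.

Set Implicit Arguments.
Unset Strict Implicit.
Unset Printing Implicit Defensive.

Import GRing.Theory.
Local Open Scope classical_set_scope.
Local Open Scope group_scope.
Local Open Scope quotient_scope.

Section Subgroups.
Variable G : groupType.
Implicit Types (H K S : set G).

Definition is_subgroup H : Prop :=
  H 1 /\ forall x y, H x -> H y -> H (x * y^-1).

Definition is_normal H : Prop :=
  is_subgroup H /\ forall x g, H x -> H (x ^ g).

Definition gen_subgroup S : set G := smallest is_subgroup S.

Definition normal_closure S : set G := smallest is_normal S.

Definition commutators H K : set G :=
  gen_subgroup [set z | exists x y, [/\ H x, K y & z = [~ x, y]]].

(* [lower_central k] is gamma_k, with gamma_1 = G (as [lower_central_at] for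
   finite groups). *)
Definition lower_central (k : nat) : set G :=
  iter k.-1 (fun H => commutators H setT) setT.

(* G is the internal (restricted) direct product of the family D. *)
Definition direct_decomposition (I : Type) (D : I -> set G) : Prop :=
  [/\ forall i, is_normal (D i),
      gen_subgroup (\bigcup_i D i) = setT
    & forall i, D i `&` gen_subgroup (\bigcup_(j in [set j | j <> i]) D j) = [set 1]].

Lemma is_subgroup_gen S : is_subgroup (gen_subgroup S).
Proof.
split=> [H [[H1 _] _] //|x y gx gy H HH].
by have [[_ Hd] _] := HH; apply: Hd; [exact: gx | exact: gy].
Qed.

Lemma subgroup_conj H g : is_subgroup H -> is_subgroup [set x | H (x ^ g)].
Proof.
move=> [H1 Hd]; split=> [|x y /= Hx Hy]; first by rewrite /= conj1g.
by rewrite conjMg conjVg; apply: Hd.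
Qed.

Lemma normal_gen S :
  (forall x g, S x -> S (x ^ g)) -> is_normal (gen_subgroup S).
Proof.
move=> SJ; split; first exact: is_subgroup_gen.
move=> x g; apply: (smallest_sub (X := [set x | gen_subgroup S (x ^ g)])).
  exact/subgroup_conj/is_subgroup_gen.
by move=> y Sy /=; apply: sub_gen_smallest; apply: SJ.
Qed.

Lemma normal_normal_closure S : is_normal (normal_closure S).
Proof.
split; first split=> [H [[[H1 _] _] _] //|x y gx gy H HH].
  by have [[[_ Hd] _] _] := HH; apply: Hd; [exact: gx | exact: gy].
by move=> x g gx H HH; have [[_ HJ] _] := HH; apply: HJ; exact: gx.
Qed.

Lemma normal_lower_central k : is_normal (lower_central k).
Proof.
rewrite /lower_central; elim: k.-1 => [|j [_ IH]] //=.
apply: normal_gen => _ g [x [y [Hx _ ->]]].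
by exists (x ^ g), (y ^ g); split=> //; [exact: IH | rewrite conjRg].
Qed.

Record normal_subgroup := NormalSubgroup {
  normal_set :> set G;
  normal_setP : is_normal normal_set }.

Definition normal_closure_group S := NormalSubgroup (normal_normal_closure S).
Definition lower_central_group k := NormalSubgroup (normal_lower_central k).

End Subgroups.

Section Quotient.
Variables (G : groupType) (N : normal_subgroup G).

Definition coset_rel : rel G := fun x y => `[< normal_set N (x * y^-1) >].

Lemma coset_refl : reflexive coset_rel.
Proof. by move=> x; apply/asboolP; rewrite mulgV; case: (normal_setP N) => -[]. Qed.

Lemma normalV x : normal_set N x -> normal_set N x^-1.
Proof. by case: (normal_setP N) => -[N1 Nd] _ /(Nd _ _ N1); rewrite mul1g. Qed.

Lemma normalM x y : normal_set N x -> normal_set N y -> normal_set N (x * y).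
Proof.
by case: (normal_setP N) => -[N1 Nd] _ Nx /normalV /(Nd _ _ Nx); rewrite invgK.
Qed.

Lemma normalJ x g : normal_set N x -> normal_set N (x ^ g).
Proof. by case: (normal_setP N) => _; apply. Qed.

Lemma coset_sym : symmetric coset_rel.
Proof.
by move=> x y; apply/asboolP/asboolP => /normalV; rewrite invgM invgK.
Qed.

Lemma coset_trans : transitive coset_rel.
Proof.
move=> y x z /asboolP Nxy /asboolP Nyz; apply/asboolP.
by have := normalM Nxy Nyz; rewrite mulgA mulgVK.
Qed.

Canonical coset_equiv := EquivRel coset_rel coset_refl coset_sym coset_trans.

Definition quot_group : Type := {eq_quot coset_equiv}.
HB.instance Definition _ := Choice.on quot_group.
HB.instance Definition _ := EqQuotient.on quot_group.

Definition to_quot (x : G) : quot_group := \pi_quot_group x.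

Lemma to_quotP x y : to_quot x = to_quot y <-> normal_set N (x * y^-1).
Proof.
split=> [/eqP|h]; first by rewrite /to_quot eqmodE => /asboolP.
by apply/eqP; rewrite /to_quot eqmodE; apply/asboolP.
Qed.

Definition quot_one : quot_group := to_quot 1.
Definition quot_mul (x y : quot_group) : quot_group := to_quot (repr x * repr y).
Definition quot_inv (x : quot_group) : quot_group := to_quot (repr x)^-1.

Lemma quot_ind (P : quot_group -> Prop) : (forall x, P (to_quot x)) -> forall q, P q.
Proof. by move=> h q; rewrite -[q]reprK; apply: h. Qed.

Lemma repr_quot x : normal_set N (repr (to_quot x) * x^-1).
Proof. by apply/to_quotP; rewrite {1}/to_quot reprK. Qed.

Lemma to_quotM x y : to_quot (x * y) = quot_mul (to_quot x) (to_quot y).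
Proof.
apply/esym/to_quotP; set x' := repr _; set y' := repr _.
have -> : x' * y' * (x * y)^-1 = x' * x^-1 * (y' * y^-1) ^ x^-1.
  by rewrite /conjg invgK invgM !mulgA mulgVK.
by apply: normalM; [exact: repr_quot | apply/normalJ/repr_quot].
Qed.

Lemma to_quotV x : to_quot x^-1 = quot_inv (to_quot x).
Proof.
apply/to_quotP; rewrite invgK; set x' := repr _.
have -> : x^-1 * x' = (x' * x^-1) ^ x by rewrite /conjg mulgVK.
exact/normalJ/repr_quot.
Qed.

Lemma quot_mulA : associative quot_mul.
Proof.
elim/quot_ind=> x; elim/quot_ind=> y; elim/quot_ind=> z.
by rewrite -!to_quotM mulgA.
Qed.

Lemma quot_mul1 : left_id quot_one quot_mul.
Proof. by elim/quot_ind=> x; rewrite -to_quotM mul1g. Qed.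

Lemma quot_mulg1 : right_id quot_one quot_mul.
Proof. by elim/quot_ind=> x; rewrite -to_quotM mulg1. Qed.

Lemma quot_mulV : left_inverse quot_one quot_inv quot_mul.
Proof. by elim/quot_ind=> x; rewrite -to_quotV -to_quotM mulVg. Qed.

Lemma quot_mulgV : right_inverse quot_one quot_inv quot_mul.
Proof. by elim/quot_ind=> x; rewrite -to_quotV -to_quotM mulgV. Qed.

HB.instance Definition _ := isGroup.Build quot_group
  quot_mulA quot_mul1 quot_mulg1 quot_mulV quot_mulgV.

End Quotient.

(* The letter [(a, true)] is a and [(a, false)] is a^-1. *)
Definition letter (A : Type) := (A * bool)%type.
Definition word (A : Type) := seq (letter A).

Section Words.
Variable A : Type.

Definition inv_letter (l : letter A) : letter A := (l.1, ~~ l.2).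

Definition inv_word (w : word A) : word A := rev (map inv_letter w).

Definition eval_letter (G : groupType) (f : A -> G) (l : letter A) : G :=
  if l.2 then f l.1 else (f l.1)^-1.

Definition eval_word (G : groupType) (f : A -> G) (w : word A) : G :=
  \prod_(l <- w) eval_letter f l.

End Words.

Section FreeGroup.
Variable A : choiceType.
Implicit Types (l : letter A) (u v w : word A).

Definition reduced w : bool := sorted (fun l k => k != inv_letter l) w.

Definition push l w : word A :=
  if w is k :: w' then if k == inv_letter l then w' else l :: w else [:: l].

Definition reduce w : word A := foldr push [::] w.

Lemma inv_letterK : involutive (@inv_letter A).
Proof. by case=> a b; rewrite /inv_letter negbK. Qed.

Lemma reduced_push l w : reduced w -> reduced (push l w).
Proof.
case: w => [|k w] //= rw; case: ifP => [_|/negbT kl].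
  exact: path_sorted rw.
by rewrite /reduced /= kl.
Qed.

Lemma reduced_foldr u w : reduced w -> reduced (foldr push w u).
Proof. by move=> rw; elim: u => //= l u; apply: reduced_push. Qed.

Lemma pushK l w : reduced w -> push l (push (inv_letter l) w) = w.
Proof.
case: w => [|k w] /=; first by rewrite eqxx.
rewrite inv_letterK; case: eqP => [-> | _] /= rw; last by rewrite eqxx.
by case: w rw => //= j w /andP[/negPf -> _].
Qed.

Lemma reduce_id w : reduced w -> reduce w = w.
Proof.
elim: w => //= l w IH rw; rewrite IH; last exact: path_sorted rw.
by case: w rw {IH} => //= j w /andP[/negPf -> _].
Qed.

Lemma foldr_push l u w :
  reduced w -> foldr push w (push l u) = push l (foldr push w u).
Proof.
move=> rw; case: u => [|k u] //=; case: eqP => [-> | //].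
by rewrite pushK // reduced_foldr.
Qed.

Lemma foldr_reduce u w : reduced w -> foldr push w (reduce u) = foldr push w u.
Proof. by move=> rw; elim: u => //= l u IH; rewrite foldr_push // IH. Qed.

Lemma reduce_cat u v : reduce (u ++ v) = foldr push (reduce v) u.
Proof. exact: foldr_cat. Qed.

Lemma reduce_catl u v : reduce (reduce u ++ v) = reduce (u ++ v).
Proof. by rewrite !reduce_cat foldr_reduce ?reduced_foldr. Qed.

Lemma reduce_catr u v : reduce (u ++ reduce v) = reduce (u ++ v).
Proof. by rewrite !reduce_cat reduce_id ?reduced_foldr. Qed.

Lemma inv_wordK : involutive (@inv_word A).
Proof. by move=> w; rewrite /inv_word map_rev revK (mapK inv_letterK). Qed.

Lemma reduce_mulgV w : reduce (w ++ inv_word w) = [::].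
Proof.
elim/last_ind: w => [|w l IH] //.
rewrite /inv_word map_rcons rev_rcons cat_rcons -[RHS]IH.
rewrite !reduce_cat [reduce (l :: _)]/reduce /= pushK //.
  by rewrite reduced_foldr.
Qed.

Lemma reduce_mulVg w : reduce (inv_word w ++ w) = [::].
Proof. by rewrite -{2}[w]inv_wordK reduce_mulgV. Qed.

Lemma reduced_reduce w : reduced (reduce w).
Proof. exact: reduced_foldr. Qed.

(* The free group F(A), realised on reduced words. *)
Record free_group := FreeGroup { fg_word : word A; fg_reduced : reduced fg_word }.

HB.instance Definition _ := [isSub for fg_word].
HB.instance Definition _ := [Choice of free_group by <:].

Definition fg_of_word w : free_group :=
  FreeGroup (reduced_reduce w).

Definition fg_one : free_group := fg_of_word [::].
Definition fg_mul (x y : free_group) : free_group :=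
  fg_of_word (fg_word x ++ fg_word y).
Definition fg_inv (x : free_group) : free_group :=
  fg_of_word (inv_word (fg_word x)).

Lemma fg_mulA : associative fg_mul.
Proof.
by move=> x y z; apply: val_inj; rewrite /= reduce_catl reduce_catr catA.
Qed.

Lemma fg_mul1 : left_id fg_one fg_mul.
Proof. by move=> x; apply: val_inj; rewrite /= reduce_id // fg_reduced. Qed.

Lemma fg_mulg1 : right_id fg_one fg_mul.
Proof. by move=> x; apply: val_inj; rewrite /= cats0 reduce_id // fg_reduced. Qed.

Lemma fg_mulV : left_inverse fg_one fg_inv fg_mul.
Proof. by move=> x; apply: val_inj; rewrite /= reduce_catl reduce_mulVg. Qed.

Lemma fg_mulgV : right_inverse fg_one fg_inv fg_mul.
Proof. by move=> x; apply: val_inj; rewrite /= reduce_catr reduce_mulgV. Qed.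

HB.instance Definition _ := isGroup.Build free_group
  fg_mulA fg_mul1 fg_mulg1 fg_mulV fg_mulgV.

Definition fg_gen (a : A) : free_group := fg_of_word [:: (a, true)].

End FreeGroup.

Section Presentation.
Variables (c n m : nat).
Variable r : 'I_m -> word 'I_n.

Definition free_nilpotent : groupType :=
  quot_group (lower_central_group (free_group 'I_n) c.+1).

Definition free_nilpotent_gen (j : 'I_n) : free_nilpotent :=
  to_quot (lower_central_group (free_group 'I_n) c.+1) (fg_gen j).

Definition nilpotent_presentation : groupType :=
  quot_group (normal_closure_group
    (range (fun i => eval_word free_nilpotent_gen (r i)))).

Definition exponent_sum (j : 'I_n) (w : word 'I_n) : int :=
  (\sum_(l <- w | l.1 == j) if l.2 then 1 else -1)%R.

Definition relation_matrix : 'M[int]_(m, n) :=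
  (\matrix_(i < m, j < n) exponent_sum j (r i))%R.

Definition full_rank : Prop :=
  \rank (map_mx intr relation_matrix : 'M[rat]_(m, n)) = minn m n.

End Presentation.

(* Main.v *)
Require Import Defs.
From HB Require Import structures.
From mathcomp Require Import all_boot all_order all_algebra.
From mathcomp Require Import all_classical.
From mathcomp Require Import ring.

(** Let M be the relation matrix. It has rank m because m < n, so its rows are
    linearly independent over the rationals, and the linear systems M z = b are
    all solvable.

    Key point ([commuting_characters]): if phi and psi are homomorphisms from
    G to the additive group of rationals and p, q commute in G, then
    phi p * psi q = phi q * psi p. Indeed send a_j to the unitriangular
    Heisenberg matrix with off-diagonal entries phi a_j, psi a_j and corner
    entry z_j. The Heisenberg group has class 2 <= c, so this extends to N_c(A).
    A relator goes to a central element, whose corner entry is (M z)_i plus a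
    number that depends on phi and psi only; since M has independent rows, z
    can be chosen to kill all relators, and we get a homomorphism from G to the
    Heisenberg group lifting (phi, psi). Commuting elements have commuting
    images, and two Heisenberg matrices commute exactly when
    phi p * psi q = phi q * psi p.

    Now let G be the direct product of the D_i. A nonzero vector in the kernel
    of M, which exists as m < n, gives a character chi of G with chi h <> 0 for
    some h in some D_i; this D_i is infinite. Suppose D_j is infinite with
    j <> i. It is isomorphic to the quotient of G by the product of the other
    factors, a finitely generated nilpotent group; an infinite such group has a
    nonzero character ([fg_nilpotent_finite_or_character]). This yields a
    character phi of G that vanishes on D_i but not at some k in D_j. Since h
    and k commute, chi h * phi k = chi k * phi h = 0, a contradiction. *)

Set Implicit Arguments.
Unset Strict Implicit.
Unset Printing Implicit Defensive.

Import GRing.Theory Num.Theory.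
Local Open Scope classical_set_scope.
Local Open Scope group_scope.

(** * Group homomorphisms and quotients *)

Notation group_hom G H := (UMagmaMorphism.type G H).

Lemma morph_div (G H : groupType) (f : G -> H) :
  {morph f : x y / x * y} -> {morph f : x y / x / y}.
Proof. by move=> fM x y; apply: (mulIg (f y)); rewrite -fM !mulgVK. Qed.

HB.instance Definition _ (G : groupType) (N : normal_subgroup G) :=
  isGroupMorphism.Build G (quot_group N) (to_quot N)
    (morph_div (@to_quotM G N)).

Lemma to_quot_eq1 (G : groupType) (N : normal_subgroup G) x :
  to_quot N x = 1 <-> normal_set N x.
Proof. by rewrite -[1]/(to_quot N 1) to_quotP invg1 mulg1. Qed.

Lemma quot_lift (G H : groupType) (N : normal_subgroup G) (f : group_hom G H) :
  (forall x, normal_set N x -> f x = 1) ->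
  exists g : group_hom (quot_group N) H, forall x, g (to_quot N x) = f x.
Proof.
move=> Nf; pose g (q : quot_group N) : H := f (repr q).
have gE x : g (to_quot N x) = f x.
  apply: divg1_eq; rewrite /g -gmulfF; exact/Nf/repr_quot.
have gM : {morph g : p q / p * q}.
  elim/quot_ind=> x; elim/quot_ind=> y; by rewrite -gmulfM !gE gmulfM.
pose g' : group_hom _ _ := HB.pack g (isGroupMorphism.Build _ _ g (morph_div gM)).
by exists g'.
Qed.

(** * Subgroups and the lower central series *)

Section Subgroups.
Variable G : groupType.
Implicit Types H K S : set G.

Lemma subgroup1 H : is_subgroup H -> H 1. Proof. by case. Qed.

Lemma subgroupV H x : is_subgroup H -> H x -> H x^-1.
Proof. by case=> H1 HF /(HF _ _ H1); rewrite mul1g. Qed.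

Lemma subgroupM H x y : is_subgroup H -> H x -> H y -> H (x * y).
Proof. by move=> sH Hx /(subgroupV sH) /(proj2 sH _ _ Hx); rewrite invgK. Qed.

Lemma subgroupX H x k : is_subgroup H -> H x -> H (x ^+ k).
Proof.
move=> sH Hx; elim: k => [|k IH]; first exact: subgroup1.
by rewrite expgS; apply: subgroupM.
Qed.

Lemma gen_subgroup_sub S H : is_subgroup H -> S `<=` H -> gen_subgroup S `<=` H.
Proof. exact: smallest_sub. Qed.

Lemma sub_gen_subgroup S : S `<=` gen_subgroup S.
Proof. exact: sub_gen_smallest. Qed.

Lemma commutator_normal H x y : is_normal H -> H x -> H [~ x, y].
Proof.
case=> sH HJ Hx; rewrite commgEl.
by apply: subgroupM => //; [apply: subgroupV | apply: HJ].
Qed.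

Lemma mem_commutators H K x y : H x -> K y -> commutators H K [~ x, y].
Proof. by move=> Hx Ky; apply: sub_gen_subgroup; exists x, y. Qed.

Lemma lower_centralS k : @lower_central G k.+1 `<=` @lower_central G k.
Proof.
case: k => // k; apply: gen_subgroup_sub.
  by case: (normal_lower_central G k.+1).
move=> _ [x [y [Hx _ ->]]]; apply: commutator_normal => //.
exact: (normal_lower_central G k.+1).
Qed.

Lemma lower_central_antimono j k : (j <= k)%N ->
  @lower_central G k `<=` @lower_central G j.
Proof.
move=> /subnK <-; elim: (k - j)%N => // i IH x /lower_centralS; exact: IH.
Qed.

Lemma finite_subgroup_torsion H x : is_subgroup H -> finite_set H -> H x ->
  exists2 k, (0 < k)%N & x ^+ k = 1.
Proof.
move=> sH finH Hx; apply: contrapT => x_free.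
have inj_pow : injective (fun k => x ^+ k).
  have lt_neq i j : (i < j)%N -> x ^+ i = x ^+ j -> False.
    move=> ij e; apply: x_free; exists (j - i)%N; first by rewrite subn_gt0.
    by rewrite expgnFr ?e ?mulgV // ltnW.
  move=> i j e; case: (ltngtP i j) => // ij; first by case: (lt_neq i j).
  by case: (lt_neq j i).
apply: infinite_nat; rewrite -(@preimage_setT _ _ (fun k => x ^+ k)).
apply: (@sub_finite_set _ _ ((fun k => x ^+ k) @^-1` H)).
  by move=> k _; apply: subgroupX.
by apply: finite_preimage => // i j _ _; apply: inj_pow.
Qed.
End Subgroups.

Section Homs.
Variables G H : groupType.
Implicit Types f : group_hom G H.

Lemma preim_subgroup f (K : set H) : is_subgroup K -> is_subgroup (f @^-1` K).
Proof.
move=> [K1 KF]; split=> [|x y]; rewrite /preimage /= ?gmulf1 //.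
by rewrite gmulfF; apply: KF.
Qed.

Lemma image_subgroup f (K : set G) : is_subgroup K -> is_subgroup (f @` K).
Proof.
move=> [K1 KF]; split; first by exists 1; rewrite ?gmulf1.
by move=> _ _ [x Kx <-] [y Ky <-]; exists (x / y); rewrite ?gmulfF //; apply: KF.
Qed.

Lemma lower_central_preim f k : lower_central k `<=` f @^-1` (lower_central k).
Proof.
case: k => // k; elim: k => // k IH; apply: gen_subgroup_sub.
  apply: preim_subgroup; exact: (normal_lower_central H k.+2).1.
move=> _ [x [y [Gx _ ->]]]; rewrite /preimage /= gmulfR.
by apply: mem_commutators => //; apply: IH.
Qed.

Lemma lower_central_image f k : (forall y, exists x, f x = y) ->
  lower_central k `<=` f @` (lower_central k).
Proof.
move=> f_surj; case: k => [|k].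
  by move=> y _; case: (f_surj y) => x; exists x.
elim: k => [|k IH]; first by move=> y _; case: (f_surj y) => x; exists x.
apply: gen_subgroup_sub.
  apply: image_subgroup; exact: (normal_lower_central G k.+2).1.
move=> _ [_ [y [/IH[x Gx <-] _ ->]]]; have [z <-] := f_surj y.
by exists [~ x, z]; rewrite ?gmulfR //; apply: mem_commutators.
Qed.

Lemma kernel_normal f : is_normal (f @^-1` [set 1]).
Proof.
split; first by apply: preim_subgroup; split=> // _ _ -> ->; rewrite /= mulgV.
by move=> x g; rewrite /preimage /= gmulfJ => ->; rewrite conj1g.
Qed.
End Homs.

(** * Homomorphisms to additive groups, and evaluation of words *)

Section Additive.
Variables (G : groupType) (V : zmodType) (phi : G -> V).
Hypothesis phiM : {morph phi : x y / x * y >-> (x + y)%R}.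

Lemma morph_add1 : phi 1 = 0%R.
Proof. by apply: (addrI (phi 1)); rewrite -phiM mulg1 addr0. Qed.

Lemma morph_addV x : phi x^-1 = (- phi x)%R.
Proof. by apply: (addrI (phi x)); rewrite -phiM mulgV morph_add1 subrr. Qed.
End Additive.

Definition rational_character (G : groupType) (phi : G -> rat) : Prop :=
  {morph phi : x y / x * y >-> (x + y)%R}.

Lemma character_subgroup (G : groupType) (phi : G -> rat) :
  rational_character phi -> is_subgroup [set g | phi g = 0%R].
Proof.
move=> phiM; split=> [|x y /= x0 y0]; first exact: morph_add1.
by rewrite phiM (morph_addV phiM) x0 y0 subr0.
Qed.

(** A finite subgroup is torsion, and characters vanish on torsion. *)
Lemma character_neq0_infinite (G : groupType) (phi : G -> rat) (H : set G) h :
  rational_character phi -> is_subgroup H -> H h -> phi h != 0%R -> infinite_set H.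
Proof.
move=> phiM sH Hh phih /finite_subgroup_torsion -/(_ _ sH Hh) [k k0 hk].
have phiX i : phi (h ^+ i.+1) = (phi h *+ i.+1)%R.
  by elim: i => [|i IH]; [rewrite expg1 | rewrite expgS phiM IH -mulrS].
case: k k0 hk => // k _ hk; have := phiX k.
rewrite hk (morph_add1 phiM) => /esym/eqP.
by rewrite mulrn_eq0 (negPf phih).
Qed.

Section Words.
Variable n : nat.
Implicit Types w : word 'I_n.

Definition generates (G : groupType) (a : 'I_n -> G) : Prop :=
  forall g, exists w, g = eval_word a w.

Lemma gmulf_eval_word (G H : groupType) (f : group_hom G H) (a : 'I_n -> G) w :
  f (eval_word a w) = eval_word (f \o a) w.
Proof.
rewrite /eval_word gmulf_prod; apply: eq_bigr => -[j []] _ //.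
by rewrite /eval_letter /= gmulfV.
Qed.

Lemma generates_quot (G : groupType) (N : normal_subgroup G) (a : 'I_n -> G) :
  generates a -> generates (to_quot N \o a).
Proof.
move=> gen_a; elim/quot_ind=> x; have [w ->] := gen_a x.
by exists w; rewrite gmulf_eval_word.
Qed.

Lemma sum_exponent_cons (V : zmodType) (v : 'I_n -> V) l w :
  (\sum_j v j *~ exponent_sum j (l :: w) =
  (if l.2 then v l.1 else - v l.1) + \sum_j v j *~ exponent_sum j w)%R.
Proof.
have -> : (if l.2 then v l.1 else - v l.1)%R =
    (\sum_j v j *~ (if l.1 == j then if l.2 then 1 else -1 else 0))%R.
  rewrite (bigD1 l.1) //= eqxx big1 ?addr0 => [|j /negPf jl].
    by case: l.2; rewrite ?mulr1z ?mulrN1z.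
  by rewrite eq_sym jl mulr0z.
rewrite -big_split; apply: eq_bigr => j _ /=.
rewrite -mulrzDr /exponent_sum big_cons /=.
by case: eqP; rewrite ?add0r.
Qed.

Lemma eval_word_additive (G : groupType) (V : zmodType) (phi : G -> V)
    (a : 'I_n -> G) w :
  {morph phi : x y / x * y >-> (x + y)%R} ->
  phi (eval_word a w) = (\sum_j phi (a j) *~ exponent_sum j w)%R.
Proof.
move=> phiM; elim: w => [|l w IH].
  rewrite /eval_word big_nil (morph_add1 phiM) big1 // => j _.
  by rewrite /exponent_sum big_nil mulr0z.
rewrite sum_exponent_cons -IH /eval_word big_cons phiM; congr (_ + _)%R.
by case: l => j []; rewrite /eval_letter /= ?(morph_addV phiM).
Qed.

Lemma eq_character (G : groupType) (a : 'I_n -> G) (phi psi : G -> rat) :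
  generates a -> rational_character phi -> rational_character psi ->
  (forall j, phi (a j) = psi (a j)) -> phi =1 psi.
Proof.
move=> gen_a phiM psiM eq_a g; have [w ->] := gen_a g.
by rewrite !(eval_word_additive a w) //; apply: eq_bigr => j _; rewrite eq_a.
Qed.

Lemma fg_of_word_eval w : fg_of_word w = eval_word (@fg_gen 'I_n) w.
Proof.
rewrite /eval_word; elim: w => [|l w IH]; first by rewrite big_nil.
have fg_letter : fg_of_word [:: l] = eval_letter (@fg_gen 'I_n) l.
  by case: l => i [] //; apply: val_inj.
rewrite big_cons -IH -fg_letter; apply: val_inj.
by rewrite -[RHS]/(reduce ([:: l] ++ reduce w)) reduce_catr.
Qed.

Lemma generates_fg_gen : generates (@fg_gen 'I_n).
Proof.
move=> u; exists (fg_word u); rewrite -fg_of_word_eval.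
by apply: val_inj; rewrite /= reduce_id // fg_reduced.
Qed.

Lemma eval_word_reduce (G : groupType) (a : 'I_n -> G) w :
  eval_word a (reduce w) = eval_word a w.
Proof.
rewrite /eval_word; elim: w => [|l w IH] //.
rewrite [RHS]big_cons -{}IH [reduce _]/(push l (reduce w)).
case: (reduce w) => [|k v] /=; first by rewrite big_cons.
case: eqP => [->|_]; rewrite !big_cons // mulgA -[LHS]mul1g; congr (_ * _).
by case: l => i []; rewrite /eval_letter /= ?mulgV ?mulVg.
Qed.

Lemma free_group_lift (G : groupType) (a : 'I_n -> G) :
  exists f : group_hom (free_group 'I_n) G, forall j, f (fg_gen j) = a j.
Proof.
pose f (u : free_group 'I_n) := eval_word a (fg_word u).
have fM : {morph f : u v / u * v}.
  by move=> u v; rewrite /f /= eval_word_reduce /eval_word big_cat.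
pose f' : group_hom _ _ := HB.pack f (isGroupMorphism.Build _ _ f (morph_div fM)).
exists f' => j; by rewrite /= /f /= /eval_word big_seq1.
Qed.
End Words.

(** * A finitely generated infinite nilpotent group has a nonzero character *)

Lemma row_free_col_mx (F : fieldType) (k n : nat) (A : 'M[F]_(k, n))
    (u : 'rV[F]_n) :
  row_free A -> ~~ (u <= A)%MS -> row_free (col_mx A u).
Proof.
move=> fA uA; rewrite -row_leq_rank; apply: (@leq_trans k.+1).
  by rewrite addn1.
case: (addsmxE A u) => <- _.
suff : (A < A + u)%MS by move/rank_ltmx; rewrite (eqP fA).
by rewrite ltmxE addsmxSl /= addsmx_sub submx_refl.
Qed.

Section ZmoduleForms.
Local Open Scope ring_scope.

(** Consider the integer vectors e with \sum_j e_j f_j = 0. If they span a proper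
    subspace of Q^n, a linear form vanishing on them induces phi. If they span
    Q^n, the adjugate of a matrix B made of n independent relations shows that
    \det B kills all generators, so V is finite. *)
Lemma fg_zmodule_finite_or_rational_form (V : zmodType) (n : nat)
    (f : 'I_n -> V) :
  (forall v, exists e : 'rV[int]_n, v = \sum_j f j *~ e 0 j) ->
  finite_set [set: V] \/
  exists2 phi : V -> rat, {morph phi : u v / u + v} & exists v, phi v != 0.
Proof.
move=> gen_f; pose comb (e : 'rV[int]_n) := \sum_j f j *~ e 0 j.
have combD : {morph comb : d e / d + e}.
  move=> d e; rewrite /comb -big_split; apply: eq_bigr => j _.
  by rewrite !mxE mulrzDr.
have combN : {morph comb : e / - e}.
  by move=> e; rewrite /comb -sumrN; apply: eq_bigr => j _; rewrite !mxE mulrNz.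
have combZ a e : comb (a *: e) = comb e *~ a.
  by rewrite /comb mulrz_suml; apply: eq_bigr => j _; rewrite !mxE mulrC mulrzA.
have comb0 : comb 0 = 0.
  by rewrite /comb big1// => j _; rewrite mxE mulr0z.
have comb_sum (I : finType) (F : I -> 'rV_n) :
    comb (\sum_i F i) = \sum_i comb (F i).
  exact: (big_morph comb combD comb0).
pose toQ k (B : 'M[int]_(k, n)) : 'M[rat]_(k, n) := map_mx intr B.
pose relmx k := exists2 B : 'M[int]_(k, n),
  (forall i, comb (row i B) = 0) & row_free (toQ k B).
have ex_relmx : exists k, `[< relmx k >].
  exists 0; apply/asboolP; exists 0 => [[]//|].
  by rewrite -row_leq_rank.
have ub_relmx k : `[< relmx k >] -> (k <= n)%N.
  by move=> /asboolP[B _ /eqP <-]; exact: rank_leq_col.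
case: (ex_maxnP ex_relmx ub_relmx) => k /asboolP[B combB fB] kmax.
(* By maximality of k, the rows of B span all relations over the rationals. *)
have spanB e : comb e = 0 -> (toQ _ e <= toQ _ B)%MS.
  move=> e0; apply/negPn/negP => eB.
  suff: (k + 1 <= k)%N by rewrite addn1 ltnn.
  apply: kmax; apply/asboolP; exists (col_mx B e); last first.
    by rewrite /toQ map_col_mx; apply: row_free_col_mx.
  move=> i; case: (split_ordP i) => j ->; first by rewrite rowKu combB.
  by rewrite rowKd [row j e](_ : _ = e) //; apply/rowP => l; rewrite mxE ord1.
have comb_delta j : comb (delta_mx 0 j) = f j.
  rewrite /comb (bigD1 j) //= big1 ?addr0 => [|i ij].
    by rewrite mxE !eqxx mulr1z.
  by rewrite mxE eqxx (negPf ij) mulr0z.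
have [coker0|] := eqVneq (cokermx (toQ _ B)) 0; last first.
  move/matrix0Pn => [i [j ij]]; right.
  (* A nonzero column of the cokernel of B is a form vanishing on relations. *)
  pose l : 'cV[rat]_n := col j (cokermx (toQ _ B)).
  have lrel e : comb e = 0 -> toQ _ e *m l = 0.
    move=> /spanB; rewrite submxE => /eqP e0.
    by rewrite /l colE mulmxA e0 mul0mx.
  pose ev (v : V) := projT1 (cid (gen_f v)).
  have evE v : comb (ev v) = v by rewrite /ev; case: (cid _).
  pose phi v := (toQ _ (ev v) *m l) 0 0.
  have phiE e : phi (comb e) = (toQ _ e *m l) 0 0.
    have := lrel (ev (comb e) - e); rewrite combD combN evE subrr => /(_ erefl).
    rewrite /toQ map_mxB mulmxBl => /eqP; rewrite subr_eq0 => /eqP.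
    by rewrite /phi => ->.
  exists phi; last first.
    exists (f i); rewrite -comb_delta phiE /toQ map_delta_mx -rowE.
    by rewrite mxE /l mxE.
  move=> u v; rewrite -[u]evE -[v]evE -combD !phiE /toQ map_mxD mulmxDl.
  by rewrite mxE.
left.
have kn : k = n.
  by move/eqP: coker0; rewrite cokermx_eq0 => /eqP; rewrite (eqP fB).
move: B combB fB {kmax spanB coker0}; rewrite {}kn => B combB fB.
pose d := \det B.
have d0 : d != 0.
  move: fB; rewrite row_free_unit unitmxE unitfE det_map_mx.
  by rewrite intr_eq0.
have fd j : f j *~ d = 0.
  have -> : f j *~ d = comb (row j (\adj B *m B)).
    by rewrite mul_adj_mx -scalemx1 linearZ /= row1 combZ comb_delta.
  rewrite row_mul mulmx_sum_row comb_sum big1 // => i _.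
  by rewrite combZ combB mul0rz.
(* As d kills the generators, coefficients matter modulo d only. *)
pose S : {ffun 'I_n -> 'I_(`|d|%N)} -> V := fun e => \sum_j f j *+ e j.
apply: (@sub_finite_set _ _ (S @` setT)); last exact/finite_image/finite_finset.
move=> v _; have [e ->] := gen_f v.
have lt_mod (x : int) : (`|(x %% d)%Z| < `|d|)%N.
  by rewrite -ltz_nat gez0_abs ?modz_ge0 // abszE ltz_mod.
exists [ffun j => Ordinal (lt_mod (e 0 j))] => //; apply: eq_bigr => j _.
rewrite ffunE /= pmulrn gez0_abs ?modz_ge0 //.
by rewrite [in RHS](divz_eq (e 0 j) d) [RHS]mulrzDr -mulrzA_C fd mul0rz add0r.
Qed.

End ZmoduleForms.

(** A copy of the quotient by the derived subgroup that carries an additive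
    structure, so that integer multiples and sums are available. *)
Definition abelianization (G : groupType) : Type :=
  quot_group (lower_central_group G 2).

Section Abelianization.
Variable G : groupType.
HB.instance Definition _ := Choice.on (abelianization G).

Let ab_mul (u v : abelianization G) : abelianization G :=
  @quot_mul G (lower_central_group G 2) u v.
Let ab_inv (u : abelianization G) : abelianization G :=
  @quot_inv G (lower_central_group G 2) u.
Let ab_one : abelianization G := quot_one (lower_central_group G 2).

Lemma ab_mulC : commutative ab_mul.
Proof.
elim/quot_ind=> x; elim/quot_ind=> y; rewrite /ab_mul -!to_quotM.
apply/to_quotP.
have -> : x * y * (y * x)^-1 = [~ x^-1, y^-1].
  by rewrite /commg /conjg !invgK invgM !mulgA.
exact: mem_commutators.
Qed.

HB.instance Definition _ := GRing.isZmodule.Build (abelianization G)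
  (@quot_mulA G _ : associative ab_mul) ab_mulC
  (@quot_mul1 G _ : left_id ab_one ab_mul)
  (@quot_mulV G _ : left_inverse ab_one ab_inv ab_mul).

Definition to_ab (x : G) : abelianization G :=
  to_quot (lower_central_group G 2) x.

Lemma to_abM : {morph to_ab : x y / x * y >-> (x + y)%R}.
Proof. exact: to_quotM. Qed.
End Abelianization.

Lemma abelianization_finite_or_character (G : groupType) (n : nat)
    (a : 'I_n -> G) :
  generates a ->
  finite_set [set: abelianization G] \/
  exists2 phi : G -> rat, rational_character phi & exists x, phi x != 0%R.
Proof.
move=> gen_a.
case: (@fg_zmodule_finite_or_rational_form _ n (@to_ab G \o a)) => [v|fin|].
- have [x ->] : exists x, v = to_ab x by elim/quot_ind: v => x; exists x.
  have [w ->] := gen_a x; exists (\row_j exponent_sum j w)%R.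
  rewrite (eval_word_additive _ _ (@to_abM G)).
  by apply: eq_bigr => j _; rewrite mxE.
- by left.
case=> phi phiD [v phiv]; right; exists (phi \o @to_ab G).
  by move=> x y /=; rewrite to_abM phiD.
by elim/quot_ind: v phiv => x; exists x.
Qed.

(** By induction on s: <a, s> is the product set of the cyclic group of a and
    of the finite group <s>, as these commute. *)
Lemma finite_gen_commuting_torsion (G : groupType) (s : seq G) :
  (forall x y, x \in s -> y \in s -> commute x y) ->
  (forall x, x \in s -> exists2 k, (0 < k)%N & x ^+ k = 1) ->
  finite_set (gen_subgroup [set` s]).
Proof.
elim: s => [|a s IH] comm_s tors_s.
  apply: (@sub_finite_set _ _ [set 1]) => //; apply: gen_subgroup_sub => //.
  by split=> // _ _ -> ->; rewrite mulgV.
have finB : finite_set (gen_subgroup [set` s]).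
  apply: IH => [x y xs ys|x xs]; [apply: comm_s | apply: tors_s];
  by rewrite inE ?xs ?ys orbT.
have [k k0 ak] := tors_s a (mem_head _ _).
set B := gen_subgroup _ in finB.
have sB : is_subgroup B by apply: is_subgroup_gen.
have aB b : B b -> commute a b.
  apply: (@gen_subgroup_sub _ _ [set b | commute a b]).
    split=> [|x y ax ay /=]; first exact: commute1.
    by apply: commuteM => //; apply: commuteV.
  by move=> x /= xs; apply: comm_s; rewrite inE ?eqxx ?xs ?orbT.
pose A := [set x | exists2 i, (i < k)%N & x = a ^+ i].
have finA : finite_set A.
  apply: (@sub_finite_set _ _ ((fun i => a ^+ i) @` `I_k)); last first.
    exact/finite_image/finite_II.
  by move=> _ [i ik ->]; exists i.
have sA : is_subgroup A.
  have ak_mod i : a ^+ i = a ^+ (i %% k).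
    by rewrite {1}(divn_eq i k) expgnDr mulnC expgnA ak expg1n mul1g.
  split; first by exists 0%N.
  move=> _ _ [i ik ->] [j jk ->].
  exists ((i + (k - j)) %% k)%N; first by rewrite ltn_mod.
  by rewrite -ak_mod expgnDr expgnFr 1?ltnW // ak mul1g.
apply: (@sub_finite_set _ _ [set a * b | a in A & b in B]); last first.
  exact: finite_image2.
apply: gen_subgroup_sub; last first.
  move=> x /=; rewrite inE => /orP[/eqP ->|xs].
    exists a; last by exists 1; [exact: subgroup1 | rewrite mulg1].
    exists (1 %% k)%N; first by rewrite ltn_mod.
    by case: k k0 ak {A finA sA} => [|[|k]].
  exists 1; first exact: subgroup1.
  by exists x; rewrite ?mul1g //; apply: sub_gen_subgroup.
split.
  exists 1; first exact: subgroup1.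
  by exists 1; [exact: subgroup1 | rewrite mulg1].
move=> _ _ [_ [i ik ->] [b Bb <-]] [_ [j jk ->] [b' Bb' <-]].
exists (a ^+ i / a ^+ j); first by apply: (proj2 sA); [exists i | exists j].
exists (b / b'); first exact: (proj2 sB).
have bb'_j : commute (b / b') (a ^+ j)^-1.
  by apply/commuteV/commuteX/commute_sym/aB; apply: (proj2 sB).
by rewrite invgM -!mulgA -bb'_j !mulgA.
Qed.

Lemma commg_pow (G : groupType) (x y : G) k :
  commute [~ x, y] y -> [~ x, y ^+ k] = [~ x, y] ^+ k.
Proof.
move=> cy; apply: (mulgI x); rewrite commgEl mulVKg.
elim: k => [|k IH]; first by rewrite conjg1 mulg1.
rewrite expgSr conjgM IH conjMg [x ^ y](_ : _ = x * [~ x, y]); last first.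
  by rewrite commgEl mulVKg.
by rewrite conjXg (_ : _ ^ y = [~ x, y]) ?expgS ?mulgA //;
  apply/conjg_fixP/commgP.
Qed.

(** By induction on the class, starting from the abelianization in class 1.
    In class c > 1, let Z be the c-th term of the lower central series, which is
    central. If G has no nonzero character, neither has G / Z,
    which is thus finite by induction. The commutators generating Z depend on
    their entries modulo the central subgroup Z only, so they are finitely many;
    they have finite order, because [x, y]^k = [x, y^k] and y^k lies in Z for
    some k > 0.
    Hence Z is finite, and so is G. *)
Lemma fg_nilpotent_finite_or_character (c : nat) :
  forall (G : groupType) (n : nat) (a : 'I_n -> G),
  generates a -> @lower_central G c.+1 `<=` [set 1] ->
  finite_set [set: G] \/
  exists2 phi : G -> rat, rational_character phi & exists x, phi x != 0%R.
Proof.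
case: c => [|c].
  by move=> G n a _ nilG; left; apply: sub_finite_set nilG (finite_set1 _).
elim: c => [|c IH] G n a gen_a nilG.
  have [finG|] := abelianization_finite_or_character gen_a; last by right.
  left; rewrite -(@preimage_setT _ _ (@to_ab G)).
  apply: finite_preimage => // x y _ _ /to_quotP /nilG.
  exact: divg1_eq.
pose Z : set G := lower_central c.+2.
pose Q := quot_group (lower_central_group G c.+2).
pose q : group_hom G Q := to_quot (lower_central_group G c.+2).
have nilQ : @lower_central Q c.+2 `<=` [set 1].
  move=> y /(@lower_central_image _ _ q) [|x Zx <-].
    by elim/quot_ind=> z; exists z.
  exact/to_quot_eq1.
have [finQ|[phi phiM [x phix]]] := IH _ n _ (generates_quot gen_a) nilQ;
  last first.
  right; exists (phi \o q) => [y z /=|]; first by rewrite gmulfM phiM.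
  by elim/quot_ind: x phix => x; exists x.
have sZ : is_subgroup Z := (normal_lower_central G c.+2).1.
left.
have centZ z y : Z z -> commute z y.
  by move=> Zz; apply/commgP/eqP/nilG; apply: (@mem_commutators _ Z setT).
pose S := [set z | exists x y : G, lower_central c.+1 x /\ z = [~ x, y]].
have S_Z : S `<=` Z.
  move=> _ [x [y [Gx ->]]].
  exact: (@mem_commutators _ (lower_central c.+1) setT).
have finS : finite_set S.
  have commM z x y : Z z -> [~ z * x, y] = [~ x, y].
    move=> /(centZ z) cz; rewrite !commgEl conjMg invgM -mulgA; congr (_ * _).
    by rewrite (_ : z ^ y = z) ?mulKg //; apply/conjg_fixP/commgP/cz.
  have comm_repr x y : [~ repr (q x), repr (q y)] = [~ x, y].
    have qE t : exists2 z, Z z & repr (q t) = z * t.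
      exists (repr (q t) * t^-1); last by rewrite mulgVK.
      exact: (@repr_quot G (lower_central_group G c.+2)).
    have [z Zz ->] := qE x; have [z' Zz' ->] := qE y; rewrite commM //.
    by rewrite -invgR commM // invgR.
  apply: (@sub_finite_set _ _ [set [~ repr p, repr r] | p in setT & r in setT]).
    by move=> _ [x [y [_ ->]]]; exists (q x) => //; exists (q y).
  exact: finite_image2.
have tors_S z : S z -> exists2 k, (0 < k)%N & z ^+ k = 1.
  move=> Sz; have Zz := S_Z _ Sz; case: Sz Zz => [x [y [_ ->]]] Zxy.
  have [k k0 qk] : exists2 k, (0 < k)%N & q y ^+ k = 1.
    exact: (@finite_subgroup_torsion _ setT).
  exists k => //; rewrite -commg_pow; last exact: centZ.
  apply/eqP/commgP/commute_sym/centZ.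
  by apply/(@to_quot_eq1 G (lower_central_group G c.+2)); rewrite -qk -gmulfXn.
have finZ : finite_set Z.
  have [s Ss] := (finite_seqP S).1 finS.
  have sS x : x \in s -> S x by rewrite Ss.
  apply: (@sub_finite_set _ _ (gen_subgroup S)).
    move=> z; apply: gen_subgroup_sub; first exact: is_subgroup_gen.
    by move=> {}z [x [y [Gx _ ->]]]; apply: sub_gen_subgroup; exists x, y.
  rewrite Ss; apply: finite_gen_commuting_torsion => [x y xs _|x xs].
    exact: centZ (S_Z _ (sS _ xs)).
  exact: tors_S (sS _ xs).
apply: (@sub_finite_set _ _ [set z * repr p | z in Z & p in setT]).
  move=> x _; exists (x / repr (q x)); last by exists (q x); rewrite ?mulgVK.
  rewrite -invgF; apply: (subgroupV sZ).
  exact: (@repr_quot G (lower_central_group G c.+2)).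
exact: finite_image2.
Qed.

(** * The Heisenberg group *)

(** The triple (a, b, c) stands for the unitriangular matrix with rows
    (1, a, c), (0, 1, b), (0, 0, 1). *)
Definition heisenberg (R : comPzRingType) : Type := (R * R * R)%type.

Section Heisenberg.
Variable R : comPzRingType.
Local Open Scope ring_scope.
HB.instance Definition _ := Choice.on (heisenberg R).
Implicit Types p q : heisenberg R.

Definition heis_mul p q : heisenberg R :=
  (p.1.1 + q.1.1, p.1.2 + q.1.2, p.2 + q.2 + p.1.1 * q.1.2).
Definition heis_one : heisenberg R := (0, 0, 0).
Definition heis_inv p : heisenberg R :=
  (- p.1.1, - p.1.2, p.1.1 * p.1.2 - p.2).

Lemma heis_mulA : associative heis_mul.
Proof.
move=> [[a b] c] [[a' b'] c'] [[a'' b''] c''].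
by rewrite /heis_mul /=; congr (_, _, _); ring.
Qed.

Lemma heis_mul1 : left_id heis_one heis_mul.
Proof. by move=> [[a b] c]; rewrite /heis_mul /=; congr (_, _, _); ring. Qed.

Lemma heis_mulg1 : right_id heis_one heis_mul.
Proof. by move=> [[a b] c]; rewrite /heis_mul /=; congr (_, _, _); ring. Qed.

Lemma heis_mulV : left_inverse heis_one heis_inv heis_mul.
Proof.
by move=> [[a b] c]; rewrite /heis_mul /heis_one /=; congr (_, _, _); ring.
Qed.

Lemma heis_mulgV : right_inverse heis_one heis_inv heis_mul.
Proof.
by move=> [[a b] c]; rewrite /heis_mul /heis_one /=; congr (_, _, _); ring.
Qed.

HB.instance Definition _ := isGroup.Build (heisenberg R)
  heis_mulA heis_mul1 heis_mulg1 heis_mulV heis_mulgV.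

Lemma heis_commuteP p q : commute p q <-> p.1.1 * q.1.2 = q.1.1 * p.1.2.
Proof.
split=> [[_ _]|e].
  by rewrite [q.2 + _]addrC => /addrI.
rewrite /commute; congr (_, _, _) => /=; [exact: addrC..|].
by rewrite e [p.2 + _]addrC.
Qed.

Lemma heis_class2 : @lower_central (heisenberg R) 3 `<=` [set 1%g].
Proof.
pose Z : set (heisenberg R) := [set p | p.1 = (0, 0)].
have sZ : is_subgroup Z.
  split=> // -[[a b] c] [[a' b'] c'] [-> ->] [-> ->].
  by rewrite /Z /=; congr (_, _); ring.
have sub_Z : @lower_central (heisenberg R) 2 `<=` Z.
  apply: gen_subgroup_sub => // _ [p [q [_ _ ->]]].
  by rewrite /Z /=; congr (_, _); ring.
apply: gen_subgroup_sub; first by split=> // _ _ -> ->; rewrite /= mulgV.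
move=> _ [p [q [/sub_Z Zp _ ->]]]; apply/eqP/commgP/heis_commuteP.
by rewrite Zp /= mul0r mulr0.
Qed.

(** Changing the third coordinates of the generators multiplies the value of a
    word by a central element, which depends linearly on the change. *)
Lemma heis_eval_word n (x y z : 'I_n -> R) w :
  eval_word (fun j => (x j, y j, z j) : heisenberg R) w =
  let p := eval_word (fun j => (x j, y j, 0) : heisenberg R) w in
  (p.1.1, p.1.2, p.2 + \sum_j z j *~ exponent_sum j w).
Proof.
rewrite /eval_word; elim: w => [|l w IH] /=.
  rewrite !big_nil; congr (_, _, _); rewrite big1 ?addr0 // => j _.
  by rewrite /exponent_sum big_nil mulr0z.
rewrite sum_exponent_cons !big_cons {}IH.
by case: l => j []; rewrite /eval_letter /=; congr (_, _, _) => /=; ring.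
Qed.

Lemma heis_eval_word1 n (x y z : 'I_n -> R) w :
  (eval_word (fun j => (x j, y j, z j) : heisenberg R) w).1 =
  (\sum_j x j *~ exponent_sum j w, \sum_j y j *~ exponent_sum j w).
Proof.
set a := (fun j => _); rewrite [LHS]surjective_pairing; congr (_, _).
  by rewrite (eval_word_additive a w (phi := fun p : heisenberg R => p.1.1)).
by rewrite (eval_word_additive a w (phi := fun p : heisenberg R => p.1.2)).
Qed.
End Heisenberg.

(** * Nilpotent presentations of full rank *)

Section Presentation.
Variables (c n m : nat) (r : 'I_m -> word 'I_n).
Local Notation P := (nilpotent_presentation c r).

Definition presentation_gen (j : 'I_n) : P := to_quot _ (free_nilpotent_gen c j).

Lemma presentation_lift (H : groupType) (h : 'I_n -> H) :
  @lower_central H c.+1 `<=` [set 1] -> (forall i, eval_word h (r i) = 1) ->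
  exists g : group_hom P H, forall j, g (presentation_gen j) = h j.
Proof.
move=> nilH rel_h; have [f fE] := free_group_lift h.
have [f1 f1E] : exists f1 : group_hom (free_nilpotent c n) H,
    forall x, f1 (to_quot _ x) = f x.
  by apply: quot_lift => x /(lower_central_preim f) /nilH.
have [g gE] : exists g : group_hom P H, forall x, g (to_quot _ x) = f1 x.
  apply: quot_lift; apply: smallest_sub; first exact: kernel_normal.
  move=> _ [i _ <-]; rewrite /preimage /= gmulf_eval_word -[RHS](rel_h i).
  by congr eval_word; apply/funext => j; rewrite /= f1E fE.
by exists g => j; rewrite gE f1E fE.
Qed.

Lemma generates_presentation_gen : generates presentation_gen.
Proof. exact/generates_quot/generates_quot/generates_fg_gen. Qed.

Lemma presentation_nilpotent : @lower_central P c.+1 `<=` [set 1].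
Proof.
pose q1 : group_hom _ (free_nilpotent c n) := to_quot _.
pose q2 : group_hom _ P := to_quot _.
have surj1 y : exists x, q1 x = y by elim/quot_ind: y => x; exists x.
have surj2 y : exists x, q2 x = y by elim/quot_ind: y => x; exists x.
move=> y /(lower_central_image surj2)[_ /(lower_central_image surj1)[x Gx <-] <-].
have -> : q1 x = 1 by apply/to_quot_eq1.
exact: gmulf1.
Qed.

Lemma presentation_relator i : eval_word presentation_gen (r i) = 1.
Proof.
rewrite -[LHS](gmulf_eval_word (to_quot _)); apply/to_quot_eq1.
by apply: sub_gen_smallest; exists i.
Qed.

Local Notation M := (map_mx intr (relation_matrix r) : 'M[rat]_(m, n)).

Lemma relation_matrixE (v : 'I_n -> rat) i :
  ((M *m \col_j v j) i 0 = \sum_j v j *~ exponent_sum j (r i))%R.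
Proof.
by rewrite mxE; apply: eq_bigr => j _; rewrite !mxE mulrC mulrzr.
Qed.

Lemma character_relation (phi : P -> rat) : rational_character phi ->
  (M *m \col_j phi (presentation_gen j) = 0)%R.
Proof.
move=> phiM; apply/colP => i; rewrite relation_matrixE mxE.
by rewrite -(eval_word_additive _ _ phiM) presentation_relator (morph_add1 phiM).
Qed.

(** The choice of third coordinates that kills all relators is possible because
    the rows of M are independent, so that M has a right inverse. *)
Lemma heisenberg_representation (x y : 'I_n -> rat) :
  (2 <= c)%N -> row_free M ->
  (M *m \col_j x j = 0)%R -> (M *m \col_j y j = 0)%R ->
  exists g : group_hom P (heisenberg rat),
    forall j, (g (presentation_gen j)).1 = (x j, y j).
Proof.
move=> c2 freeM Mx My.
(* A choice z of third coordinates sends r_i to (0, 0, zeta_i + (M z)_i). *)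
pose zeta i := (eval_word (fun j => (x j, y j, 0%R) : heisenberg rat) (r i)).2.
pose z := (pinvmx M *m \col_i - zeta i)%R.
have Mz : (M *m \col_j z j 0 = \col_i - zeta i)%R.
  rewrite (_ : \col_j z j 0 = z)%R; last by apply/colP => j; rewrite mxE.
  by rewrite /z mulmxA mulmxVp // mul1mx.
have ker0 v i : (M *m \col_j v j = 0 -> \sum_j v j *~ exponent_sum j (r i) = 0)%R.
  by rewrite -relation_matrixE => ->; rewrite mxE.
have [|i|g gE] :=
  @presentation_lift _ (fun j => (x j, y j, z j 0%R) : heisenberg rat).
- by move=> p /(lower_central_antimono (c2 : (3 <= c.+1)%N)) /heis_class2.
- apply/eqP; rewrite -pair_eqE /=; apply/andP; split.
    by rewrite heis_eval_word1 !ker0.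
  rewrite heis_eval_word /= -relation_matrixE Mz mxE.
  by rewrite -/(zeta i) subrr.
- by exists g => j; rewrite gE.
Qed.

(** As in a nonabelian free nilpotent group, commuting elements of P have
    linearly dependent images in the rational abelianization: the lift of
    (phi, psi) to the Heisenberg group detects commutators. *)
Lemma commuting_characters (phi psi : P -> rat) (p q : P) :
  (2 <= c)%N -> row_free M ->
  rational_character phi -> rational_character psi -> commute p q ->
  (phi p * psi q = phi q * psi p)%R.
Proof.
move=> c2 freeM phiM psiM pq.
have [g gE] := heisenberg_representation c2 freeM
  (character_relation phiM) (character_relation psiM).
have phiE u : (g u).1.1 = phi u.
  apply: (eq_character (phi := fun u => (g u).1.1) generates_presentation_gen) => //.
    by move=> s t /=; rewrite gmulfM.
  by move=> j; rewrite gE.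
have psiE u : (g u).1.2 = psi u.
  apply: (eq_character (phi := fun u => (g u).1.2) generates_presentation_gen) => //.
    by move=> s t /=; rewrite gmulfM.
  by move=> j; rewrite gE.
by have /heis_commuteP := gmulf_commute g pq; rewrite !phiE !psiE.
Qed.

(** A kernel vector of M serves as both coordinates of a representation in the
    Heisenberg group, whose first coordinate is then the character. *)
Lemma nonzero_character : (2 <= c)%N -> row_free M -> (m < n)%N ->
  exists2 phi : P -> rat, rational_character phi & exists p, phi p != 0%R.
Proof.
move=> c2 freeM mn; have : (cokermx M != 0)%R.
  rewrite cokermx_eq0 -col_leq_rank -ltnNge.
  by apply: leq_ltn_trans mn; apply: rank_leq_row.
move=> /matrix0Pn[i [j ij]]; pose x k := cokermx M k j.
have Mx : (M *m \col_k x k = 0)%R.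
  have -> : (\col_k x k = col j (cokermx M))%R by apply/colP => k; rewrite !mxE.
  by rewrite colE mulmxA mulmx_coker mul0mx.
have [g gE] := heisenberg_representation c2 freeM Mx Mx.
exists (fun u => (g u).1.1); first by move=> u v; rewrite gmulfM.
by exists (presentation_gen i); rewrite gE.
Qed.

End Presentation.

(** * Direct decompositions *)

Section Decomposition.
Variables (G : groupType) (I : Type) (D : I -> set G).
Hypothesis hD : direct_decomposition D.

Definition other_factors i : set G :=
  gen_subgroup (\bigcup_(j in [set j | j <> i]) D j).

Lemma other_factors_normal i : is_normal (other_factors i).
Proof.
have [nD _ _] := hD; apply: normal_gen => x g [j ji Djx].
by exists j => //; apply: (nD j).2.
Qed.

Lemma factor_sub_other_factors i j : j <> i -> D j `<=` other_factors i.
Proof. by move=> ji x Dx; apply: sub_gen_subgroup; exists j. Qed.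

Lemma factors_commute i j x y : i <> j -> D i x -> D j y -> commute x y.
Proof.
move=> ij Dx Dy; have [nD _ capD] := hD.
apply/commgP/eqP; suff : [set 1] [~ x, y] by [].
rewrite -(capD j); split.
  rewrite -invgR; apply: subgroupV; first exact: (nD j).1.
  exact: commutator_normal.
by apply: (factor_sub_other_factors ij); apply: commutator_normal.
Qed.

Lemma character_neq0_factor (phi : G -> rat) g :
  rational_character phi -> phi g != 0%R ->
  exists i, exists2 x, D i x & phi x != 0%R.
Proof.
move=> phiM phig; apply: contrapT => D0; have [_ genD _] := hD.
suff /(_ g) : [set: G] `<=` [set g | phi g = 0%R].
  by move=> /(_ Logic.I) g0; rewrite g0 eqxx in phig.
rewrite -genD; apply: gen_subgroup_sub; first exact: character_subgroup.
by move=> x [i _ Dx]; apply: contrapT => /eqP phix; apply: D0; exists i, x.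
Qed.

(** The factor embeds in the quotient by the others, which it meets trivially. *)
Lemma infinite_factor_quotient i :
  infinite_set (D i) ->
  infinite_set [set: quot_group (NormalSubgroup (other_factors_normal i))].
Proof.
move=> infD finQ; apply: infD; have [nD _ capD] := hD.
pose q := to_quot (NormalSubgroup (other_factors_normal i)).
have injq : {in D i &, injective q}.
  move=> x y /set_mem Dx /set_mem Dy /to_quotP Kxy; apply: divg1_eq.
  suff : [set 1] (x / y) by [].
  by rewrite -(capD i); split=> //; apply: (nD i).1.2.
rewrite -(eq_finite_set (inj_card_eq injq)).
exact: sub_finite_set finQ.
Qed.
End Decomposition.

Theorem theorem4p17 (c n m : nat) (r : 'I_m -> word 'I_n)
    (hc : (2 <= c)%N) (hr : full_rank r) (hmn : (m < n)%N)
    (I : Type) (D : I -> set (nilpotent_presentation c r))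
    (hD : direct_decomposition D) :
  exists i : I, infinite_set (D i) /\
    forall j : I, j <> i -> finite_set (D j).
Proof.
have freeM : row_free (map_mx intr (relation_matrix r) : 'M[rat]_(m, n)).
  by rewrite /row_free hr (minn_idPl (ltnW hmn)).
have [nD _ _] := hD.
have [chi chiM [g chig]] := nonzero_character hc freeM hmn.
have [i [h Dh chih]] := character_neq0_factor hD chiM chig.
exists i; split; first exact: character_neq0_infinite chiM (nD i).1 Dh chih.
move=> j ji; apply: contrapT => /(infinite_factor_quotient (hD := hD)).
set N := NormalSubgroup _ => infQ.
have nilQ : @lower_central (quot_group N) c.+1 `<=` [set 1].
  have surjN y : exists x, to_quot N x = y by elim/quot_ind: y => x; exists x.
  move=> y /(lower_central_image surjN)[x /presentation_nilpotent -> <-].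
  exact: gmulf1.
have [//|[psi psiM [y psiy]]] := fg_nilpotent_finite_or_character
  (generates_quot (N := N) (@generates_presentation_gen c n m r)) nilQ.
pose phi := psi \o to_quot N.
have phiM : rational_character phi by move=> u v; rewrite /phi /= gmulfM psiM.
have phi_others x : other_factors D j x -> phi x = 0%R.
  move=> Kx; rewrite /phi /= (_ : to_quot N x = 1); last exact/to_quot_eq1.
  exact: morph_add1 psiM.
have [x phix] : exists x, phi x != 0%R.
  by elim/quot_ind: y psiy => x; exists x.
have [l [k Dk phik]] := character_neq0_factor hD phiM phix.
have lj : l = j.
  apply: contrapT => lj; move: phik; rewrite phi_others ?eqxx //.
  exact: factor_sub_other_factors lj _ Dk.
move: k Dk phik; rewrite {}lj => k Dk phik.
have hk : commute h k by apply: (factors_commute hD _ Dh Dk) => ij; apply: ji.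
have phih : phi h = 0%R.
  by apply: phi_others; apply: (factor_sub_other_factors _ Dh) => ij; apply: ji.
have := commuting_characters hc freeM chiM phiM hk.
by rewrite phih mulr0 => /eqP; rewrite mulf_eq0 (negPf chih) (negPf phik).
Qed.
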